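(* Let $m(x)=e^{x^2/2}\int_x^{\infty}e^{-t^2/2}\,dt$ be the Mills ratio of the standard normal distribution. Then for all $x>0$ $$m(x)<\frac{1-x^2+\sqrt{x^4+6x^2+1}}{4x}.$$ *)

(* Defs.v *)
From Stdlib Require Import Reals.
From Coquelicot Require Import Coquelicot.
Open Scope R_scope.

(* Mills ratio of the standard normal distribution: the common factor
   1 / sqrt (2 * PI) of the tail probability and of the density cancels. The
   integral is the improper Riemann integral over [x, +oo). *)
Definition mills (x : R) : R :=
  exp (x ^ 2 / 2) *
  RInt_gen (fun t : R => exp (- (t ^ 2 / 2))) (at_point x) (Rbar_locally p_infty).

(* Main.v *)
Require Import Defs.
From Stdlib Require Import Reals Lra.
From Coquelicot Require Import Coquelicot.
Open Scope R_scope.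

(** Write [g] for the bound and [f t = exp (- (t ^ 2 / 2))]. The claim is that
    the integral of [f] from [x] to infinity lies below [G x], where
    [G t = f t * g t], and it is enough that [G] is nonnegative and loses mass
    faster than the tail does: [G' < - f] ([RInt_gen_lt_of_decay]). Since
    [f' t = - t * f t], this is the differential inequality
    [g' - t * g + 1 < 0], the strict form of the equation [m' - t * m + 1 = 0]
    that Mills ratio satisfies. After clearing the root
    [S = sqrt (y ^ 2 + 6 * y + 1)], with [y = t ^ 2], it becomes
    [(y ^ 2 + 2 * y - 1) * S < y ^ 3 + 5 * y ^ 2 + y + 1], and the squares of
    the two sides differ by exactly [32 * y ^ 2] ([bound_poly_lt]). *)

(** The partial integrals are nondecreasing, so they converge to their
    supremum. *)
Lemma ex_RInt_gen_of_bounded (f : R -> R) (a M : R) :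
  (forall t, continuous f t) -> (forall t, 0 <= f t) ->
  (forall b, a <= b -> RInt f a b <= M) ->
  exists l, is_RInt_gen f (at_point a) (Rbar_locally p_infty) l /\ l <= M.
Proof.
intros cf f0 bM.
assert (If : forall u v, ex_RInt f u v).
{ intros u v; apply (ex_RInt_continuous (V := R_CompleteNormedModule)).
  intros; apply cf. }
destruct (completeness (fun r => exists b, a <= b /\ r = RInt f a b))
  as [l [ub lub]].
- exists M; intros r [b [ab ->]]; now apply bM.
- exists (RInt f a a), a; split; [lra | reflexivity].
- exists l; split.
  2:{ apply lub; intros r [b [ab ->]]; now apply bM. }
  intros P [eps HP].
  assert (near : exists b0, a <= b0 /\ l - eps < RInt f a b0).
  { destruct (Classical_Prop.classic
      (exists b0, a <= b0 /\ l - eps < RInt f a b0)) as [H|H]; [exact H|].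
    exfalso; assert (l <= l - eps); [|destruct eps; simpl in *; lra].
    apply lub; intros r [b [ab ->]].
    apply Rnot_lt_le; intro Hb; apply H; now exists b. }
  destruct near as [b0 [ab0 Hb0]].
  apply (Filter_prod _ _ _ (fun u => u = a) (fun v => b0 < v)).
  + reflexivity.
  + now exists b0.
  + intros u v -> Hv; exists (RInt f a v); split.
    * apply (RInt_correct (V := R_CompleteNormedModule)), If.
    * apply HP.
      assert (RInt f a v <= l) by (apply ub; exists v; split; [lra|reflexivity]).
      assert (0 <= RInt f b0 v) by (apply RInt_ge_0; [lra|apply If|intros; apply f0]).
      assert (E : RInt f a b0 + RInt f b0 v = RInt f a v)
        by (apply (RInt_Chasles (V := R_CompleteNormedModule)); apply If).
      change (Rabs (RInt f a v - l) < eps).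
      apply Rabs_def1; destruct eps; simpl in *; lra.
Qed.

(** The function [RInt f a t + G t] of [t] is strictly decreasing, so its
    values beyond [a + 1] stay below its value there, which is a fixed amount
    below [G a]. As [G] is nonnegative, that value also bounds the integrals,
    and the inequality stays strict in the limit. *)
Lemma RInt_gen_lt_of_decay (f G dG : R -> R) (a : R) :
  (forall t, continuous f t) -> (forall t, 0 <= f t) ->
  (forall t, a <= t -> 0 <= G t) ->
  (forall t, a <= t -> is_derive G t (dG t)) ->
  (forall t, a <= t -> f t + dG t < 0) ->
  RInt_gen f (at_point a) (Rbar_locally p_infty) < G a.
Proof.
intros cf f0 G0 DG lt0.
assert (If : forall u v, ex_RInt f u v).
{ intros u v; apply (ex_RInt_continuous (V := R_CompleteNormedModule)).
  intros; apply cf. }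
set (H := fun t => RInt f a t + G t).
assert (DH : forall t, a <= t -> is_derive H t (f t + dG t)).
{ intros t at_; unfold H.
  apply (is_derive_plus (K := R_AbsRing) (V := R_NormedModule)); [|now apply DG].
  apply (is_derive_RInt (V := R_NormedModule)) with (a := a); [|apply cf].
  apply filter_forall; intros u.
  apply (RInt_correct (V := R_CompleteNormedModule)), If. }
assert (dec : forall u v, a <= u -> u < v -> H v < H u).
{ intros u v au uv.
  destruct (MVT_gen H u v (fun t => f t + dG t)) as [c [Hc E]].
  - intros t Ht; apply DH; rewrite Rmin_left in Ht; lra.
  - intros t Ht; apply continuity_pt_filterlim.
    apply (ex_derive_continuous (K := R_AbsRing) (V := R_NormedModule)).
    exists (f t + dG t); apply DH; rewrite Rmin_left in Ht; lra.
  - rewrite Rmin_left, Rmax_right in Hc by lra.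
    assert (f c + dG c < 0) by (apply lt0; lra).
    nra. }
assert (Ha : H a = G a)
  by (unfold H; rewrite RInt_point; apply Rplus_0_l).
destruct (ex_RInt_gen_of_bounded f a (H (a + 1)) cf f0) as [l [Il lM]].
{ intros b ab; apply Rle_trans with (RInt f a (Rmax b (a + 1))).
  - assert (E : RInt f a b + RInt f b (Rmax b (a + 1)) = RInt f a (Rmax b (a + 1)))
      by (apply (RInt_Chasles (V := R_CompleteNormedModule)); apply If).
    assert (0 <= RInt f b (Rmax b (a + 1)))
      by (apply RInt_ge_0; [apply Rmax_l|apply If|intros; apply f0]).
    lra.
  - assert (am := Rmax_r b (a + 1)).
    assert (0 <= G (Rmax b (a + 1))) by (apply G0; lra).
    assert (Hle : H (Rmax b (a + 1)) <= H (a + 1)).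
    { destruct am as [am|<-]; [|apply Rle_refl].
      left; apply dec; lra. }
    unfold H at 1 in Hle; lra. }
rewrite (is_RInt_gen_unique (V := R_CompleteNormedModule) _ _ Il).
rewrite <- Ha; apply Rle_lt_trans with (1 := lM), dec; lra.
Qed.

(** The right-hand side is positive, so comparing squares suffices whatever the
    sign of [y ^ 2 + 2 * y - 1]. *)
Lemma bound_poly_lt (y S : R) :
  0 < y -> S ^ 2 = y ^ 2 + 6 * y + 1 ->
  (y ^ 2 + 2 * y - 1) * S < y ^ 3 + 5 * y ^ 2 + y + 1.
Proof.
intros y0 HS.
assert (0 < y ^ 3) by now apply pow_lt.
assert (0 < y ^ 2) by now apply pow_lt.
assert (E : ((y ^ 2 + 2 * y - 1) * S) ^ 2
            = (y ^ 3 + 5 * y ^ 2 + y + 1) ^ 2 - 32 * y ^ 2)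
  by (rewrite Rpow_mult_distr, HS; ring).
apply Rnot_le_lt; intro le.
assert (le2 := pow_incr _ _ 2 (conj (ltac:(lra) : 0 <= y ^ 3 + 5 * y ^ 2 + y + 1) le)).
lra.
Qed.

Theorem mainTheorem5 (x : R) (hx : 0 < x) :
  mills x < (1 - x ^ 2 + sqrt (x ^ 4 + 6 * x ^ 2 + 1)) / (4 * x).
Proof.
set (f := fun t : R => exp (- (t ^ 2 / 2))).
set (S := fun t : R => sqrt (t ^ 4 + 6 * t ^ 2 + 1)).
set (g := fun t : R => (1 - t ^ 2 + S t) / (4 * t)).
set (dg := fun t : R =>
  ((- 2 * t + (2 * t ^ 3 + 6 * t) / S t) * t - (1 - t ^ 2 + S t)) / (4 * t ^ 2)).
assert (rad0 : forall t, 0 < t ^ 4 + 6 * t ^ 2 + 1).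
{ intros t; assert (0 <= t ^ 2) by apply pow2_ge_0; nra. }
assert (S0 : forall t, 0 < S t) by (intros t; apply sqrt_lt_R0, rad0).
assert (S2 : forall t, S t ^ 2 = t ^ 4 + 6 * t ^ 2 + 1)
  by (intros t; apply pow2_sqrt; left; apply rad0).
assert (g0 : forall t, x <= t -> 0 <= g t).
{ intros t xt; unfold g; apply Rdiv_le_0_compat; [|lra].
  (* [S t ^ 2 - (1 - t ^ 2) ^ 2 = 8 * t ^ 2], so [S t] dominates [t ^ 2 - 1]. *)
  assert (S1 := S0 t); assert (S3 := S2 t).
  assert (0 <= t ^ 2) by apply pow2_ge_0.
  nra. }
assert (Dg : forall t, x <= t -> is_derive g t (dg t)).
{ intros t xt; assert (St := S0 t).
  unfold g, S; auto_derive.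
  - repeat split; try lra.
    assert (r := rad0 t); nra.
  - fold (S t) in *; unfold dg.
    replace (sqrt _) with (S t) by (unfold S; f_equal; ring).
    field; lra. }
assert (ineq : forall t, x <= t -> dg t - t * g t + 1 < 0).
{ intros t xt; assert (St := S0 t).
  assert (t0 : 0 < t ^ 2) by (apply pow_lt; lra).
  assert (P : (t ^ 4 + 2 * t ^ 2 - 1) * S t
              < t ^ 6 + 5 * t ^ 4 + t ^ 2 + 1).
  { assert (B := bound_poly_lt (t ^ 2) (S t) t0).
    rewrite <- !pow_mult in B; simpl Nat.mul in B; apply B, S2. }
  assert (E : dg t - t * g t + 1
    = ((t ^ 4 + 2 * t ^ 2 - 1) * S t + (2 * t ^ 4 + 6 * t ^ 2)
         - (1 + t ^ 2) * S t ^ 2) / (4 * t ^ 2 * S t))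
    by (unfold dg, g; field; lra).
  rewrite E, S2; apply Rdiv_neg_pos; nra. }
assert (lt : RInt_gen f (at_point x) (Rbar_locally p_infty) < f x * g x).
{ apply (RInt_gen_lt_of_decay f (fun t => f t * g t)
    (fun t => - t * f t * g t + f t * dg t)).
  - intros t; apply (ex_derive_continuous (K := R_AbsRing) (V := R_NormedModule)).
    unfold f; auto_derive; trivial.
  - intros t; left; apply exp_pos.
  - intros t xt; apply Rmult_le_pos; [left; apply exp_pos | now apply g0].
  - intros t xt; apply (is_derive_mult f g t (- t * f t) (dg t)).
    + unfold f; auto_derive; [trivial|].
      replace (t * (t * 1)) with (t ^ 2) by ring; unfold Rdiv; field.
    + now apply Dg.
    + intros; apply Rmult_comm.
  - intros t xt; assert (f0 : 0 < f t) by apply exp_pos.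
    assert (I := ineq t xt); nra. }
unfold mills; fold f.
change (exp (x ^ 2 / 2) * RInt_gen f (at_point x) (Rbar_locally p_infty)
        < g x).
replace (g x) with (exp (x ^ 2 / 2) * (f x * g x)).
- apply Rmult_lt_compat_l; [apply exp_pos | exact lt].
- unfold f; rewrite <- Rmult_assoc, <- exp_plus, Rplus_opp_r, exp_0; ring.
Qed.
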